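(* Let $f$ be a function satisfying the assumptions (A2) and (A4) stated in the context. For $c>c^*$ let $z^*$ be the optimal control for problem (P2), and let $u^-(c),u^+(c)$ and the minimum cost $E(c)$ be as defined in the context. Then, as $c\to+\infty$, one has $u^-(c)\to u^*$ and $u^+(c)\to1$. Moreover, the function $E(c)$ has the asymptotic behavior $$E(c)=c\,|\ln u^*|+\int_{u^*}^1\left(\frac{3\sqrt{f(u)}}{2u\sqrt u}+\frac{f'(u)}{2\sqrt{u f(u)}}\right)du+e(c),$$ where the additional term has size $e(c)=\mathcal{O}(1)\cdot\frac1c$ as $c\to+\infty$.
   Context: Assumption (A2) (bistable): $f\in C^2$, $f(0)=f(1)=0$, $f'(0)<0$, $f'(1)<0$, and $f$ vanishes at only one intermediate point $u^*\in\,]0,1[$, where $f'(u^* )>0$. Assumption (A4): for all $u\in[u^*,1]$, one has $(4-2\sqrt3)\,f'(u)+2u f''(u)\le 0$. Under (A2), $c^*\in\mathbb{R}$ denotes the unique speed for which there exists $U:\mathbb{R}\to[0,1]$ with $U''+c^*U'+f(U)=0$, $U(-\infty)=0$, $U(+\infty)=1$. $\mathcal{M}_c$ denotes the set of all positive, bounded Radon measures $\mu$ on $\mathbb{R}$ such that $U''+cU'+f(U)=\mu$, $U(-\infty)=0$, $U(+\infty)=1$ has a monotonically increasing solution $U$ (equation in the sense of measures). Problem (P2): given $c>c^*$, find $\mu\in\mathcal{M}_c$ which minimizes $J_1(\mu)=\int_{\mathbb{R}}\frac1U\,d\mu$, where $U$ is the profile corresponding to $\mu$. Under (A2) and (A4),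 for every $c>c^*$ the minimizer is unique up to translations and absolutely continuous, and there are points $u^*<u^-(c)<u^+(c)<1$ such that, writing $P=U'$ as a function of $U$, the optimal profile satisfies $\frac{dP}{dU}=-c-\frac{f(U)}{P}+z^*(U)$, with $$z^*(u)=\frac{3f(u)+u f'(u)}{2\sqrt{u f(u)}}+c\ \text{ if } u\in[u^-(c),u^+(c)],\qquad z^*(u)=0\ \text{ otherwise.}$$ This defines $u^-(c),u^+(c)$. The minimum cost is $$E(c)=\min_{\mu\in\mathcal{M}_c}J_1(\mu)=\int_{u^-(c)}^{u^+(c)}\frac{z^*(u)}{u}\,du .$$
   Formalization: For large c no minimizer of (P2) exists (the uncontrolled orbit from 0 ends at u* ), so E(c) is taken as the infimum of J_1, the optimal profile P as a limit of orbits of a minimizing sequence, with P(u* )=0 allowed, and u^-(c) ≥ u* replaces u^-(c) > u*. *)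

(* Defs.v *)
From HB Require Import structures.
From mathcomp Require Import all_boot all_order all_algebra.
From mathcomp Require Import all_classical all_reals all_analysis.
Set Implicit Arguments.
Unset Strict Implicit.
Unset Printing Implicit Defensive.
Import Order.TTheory GRing.Theory Num.Theory.
Import numFieldNormedType.Exports.
Local Open Scope ring_scope.
Local Open Scope classical_set_scope.

Definition C2 (R : realType) (f : R -> R) : Prop :=
  [/\ forall x, derivable f x 1, forall x, derivable f^`()%classic x 1 &
      continuous f^`(2)%classic].

(* [f] is taken on the whole line; only its values on [0, 1] matter, since all
   profiles take their values there. *)
Definition bistable (R : realType) (f : R -> R) (ustar : R) : Prop :=
  [/\ C2 f,
      [/\ f 0 = 0, f 1 = 0, f^`()%classic 0 < 0 & f^`()%classic 1 < 0],
      0 < ustar < 1,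
      forall u : R, 0 < u < 1 -> (f u = 0 <-> u = ustar) &
      0 < f^`()%classic ustar].

Definition assumption_A4 (R : realType) (f : R -> R) (ustar : R) : Prop :=
  forall u : R, ustar <= u <= 1 ->
    (4 - 2 * Num.sqrt 3) * f^`()%classic u + 2 * u * f^`(2)%classic u <= 0.

Definition wave_speed (R : realType) (f : R -> R) (c : R) : Prop :=
  exists U : R -> R,
    [/\ forall x, 0 <= U x <= 1,
        forall x, derivable U x 1 /\ derivable U^`()%classic x 1,
        forall x, U^`(2)%classic x + c * U^`()%classic x + f (U x) = 0,
        U x @[x --> -oo%R] --> (0 : R) &
        U x @[x --> +oo%R] --> (1 : R)].

Definition critical_speed (R : realType) (f : R -> R) (cstar : R) : Prop :=
  wave_speed f cstar /\ forall c, wave_speed f c -> c = cstar.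

Definition test_function (R : realType) (phi : R -> R) : Prop :=
  (forall n x, derivable phi^`(n)%classic x 1) /\
  (exists M : R, forall x, M < `|x| -> phi x = 0).

(* U'' + c U' + f(U) = mu, tested against smooth compactly supported functions.
   A monotone solution is automatically continuous. *)
Definition measure_equation (R : realType) (f : R -> R) (c : R)
    (mu : {finite_measure set (measurableTypeR R) -> \bar R}) (U : R -> R) :
    Prop :=
  forall phi : R -> R, test_function phi ->
    (\int[lebesgue_measure]_x
        (U x * phi^`(2)%classic x - c * (U x * phi^`()%classic x) + f (U x) * phi x)
     = \int[mu]_x phi x)%R.

(* mu belongs to M_c, with profile U; positive bounded Radon measures on the
   line are the finite Borel measures. *)
Definition admissible (R : realType) (f : R -> R) (c : R)
    (mu : {finite_measure set (measurableTypeR R) -> \bar R}) (U : R -> R) :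
    Prop :=
  [/\ {homo U : x y / x <= y},
      measure_equation f c mu U,
      U x @[x --> -oo%R] --> (0 : R) &
      U x @[x --> +oo%R] --> (1 : R)].

(* The inverse is the one of \bar R, so 1 / 0 = +oo: a measure acting where the
   profile vanishes has infinite cost. *)
Definition J1 (R : realType)
    (mu : {finite_measure set (measurableTypeR R) -> \bar R}) (U : R -> R) :
    \bar R :=
  (\int[mu]_x ((U x)%:E)^-1)%E.

Definition min_cost (R : realType) (f : R -> R) (c : R) : \bar R :=
  ereal_inf [set J | exists mu U, admissible f c mu U /\ J = J1 mu U].

Definition zstar (R : realType) (f : R -> R) (c um up u : R) : R :=
  if um <= u <= up
  then (3 * f u + u * f^`()%classic u) / (2 * Num.sqrt (u * f u)) + c
  else 0.

(* P is U' as a function of U along the optimal profile of (P2). A minimizer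
   (mu, U) yields the constant sequence, for which P (U x) = U' x. Sequences are
   allowed because the infimum is not always attained: for c large, (ustar, 0) is
   a stable node of the uncontrolled system, and the uncontrolled orbit leaving
   (0, 0) ends there. The optimal orbit then satisfies P ustar = 0 and is only a
   limit of orbits of admissible profiles. *)
Definition optimal_orbit (R : realType) (f : R -> R) (c : R) (P : R -> R) :
    Prop :=
  exists (mu : nat -> {finite_measure set (measurableTypeR R) -> \bar R})
         (U : nat -> R -> R),
    [/\ forall n, admissible f c (mu n) (U n),
        J1 (mu n) (U n) @[n --> \oo] --> min_cost f c &
        forall (u : R) (x : nat -> R), 0 < u < 1 ->
          (forall n, U n (x n) = u) ->
          (U n)^`()%classic (x n) @[n --> \oo] --> P u].

(* um and up are u^-(c) and u^+(c). When the minimum is attained, P > 0 on ]0, 1[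
   and then ustar < um; the degenerate case described above has P ustar = 0 and
   um = ustar. *)
Definition switching_points (R : realType) (f : R -> R) (ustar c um up : R) :
    Prop :=
  [/\ ustar <= um, um < up, up < 1,
      exists P : R -> R,
        [/\ optimal_orbit f c P,
            {within `[0, 1], continuous P},
            P 0 = 0 /\ P 1 = 0,
            (forall u : R, 0 < u < 1 -> 0 <= P u) /\
            (forall u : R, 0 < u < 1 -> u != ustar -> 0 < P u) &
            forall u : R, 0 < u < 1 -> u != um -> u != up -> 0 < P u ->
              is_derive u (1 : R) P (- c - f u / P u + zstar f c um up u)] &
      min_cost f c =
        (\int[lebesgue_measure]_(u in `[um, up]) (zstar f c um up u / u)%:E)%E].

(* Main.v *)
Require Import Defs.
From HB Require Import structures.
From mathcomp Require Import all_boot all_order all_algebra.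
From mathcomp Require Import all_classical all_reals all_analysis.
From mathcomp Require Import measurable_realfun.
From mathcomp Require Import ring lra.
Import Order.TTheory GRing.Theory Num.Theory.
Import numFieldNormedType.Exports.
Local Open Scope ring_scope.
Local Open Scope classical_set_scope.
Set Implicit Arguments.
Unset Strict Implicit.
Unset Printing Implicit Defensive.

(** The optimal orbit [P], with [P = U'] as a function of [U], is pinned down in
    the phase plane for large [c] by comparison arguments, and the expansion of
    the cost is then a computation with explicit integrals. Write [a] for [ustar]
    and let [L] be a Lipschitz constant of [f] on [0, 1].

    On [0, a] the control is switched off and [P' = - c - f / P]. As soon as
    [4 L <= c ^ 2], the line [k (a - u)] with [k = c / 2] is a supersolution,
    because [k ^ 2 - c k + L <= 0]; the orbit from (0, 0) stays below it, hence [P a = 0] ([uncontrolled_orbit_lands]). To the right of [a],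
    where [f > 0], an uncontrolled orbit decreases and could not leave zero, so
    the control starts at once: [um c] equals [ustar].

    On [ustar, up] the feedback makes [s u = sqrt (u f u)] a solution, and the
    difference [P - s] can only grow slower than [u] while it is positive; since
    it vanishes at [ustar], [P <= s] ([controlled_orbit_below_arc]). On [up, 1]
    the orbit is uncontrolled again, so [P' <= - c] and [P up >= c (1 - up)].
    Together with [f up <= L (1 - up)] this gives [c ^ 2 (1 - up) <= L]
    ([fast_switching_points]).

    The control density [zstar / u] is [arc_density f u + c / u]. The second term
    integrates to [c (ln up - ln um)]. The first has integrable square-root
    singularities at [ustar] and 1, where [f] vanishes to first order
    ([arc_density_bound]), so that cutting the integral at [up] costs
    [O (sqrt (1 - up)) = O (1 / c)] ([edge_weight_dominated]); and
    [c ln up = O (c (1 - up)) = O (1 / c)]. *)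

(** * A comparison principle *)

(** If [h b > 0], then [h] is positive, hence nonincreasing, after its last
    nonpositive point. Differentiability is asked only where [h > 0]: this is what
    allows comparisons with orbits whose equation is singular at [P = 0]. *)
Lemma nonpos_barrier (R : realType) (h : R -> R) (a b : R) :
  a <= b -> {within `[a, b], continuous h} -> h a <= 0 ->
  (forall x, a < x < b -> 0 < h x -> exists2 d, is_derive x (1 : R) h d & d <= 0) ->
  h b <= 0.
Proof.
move=> ab ch ha dh; rewrite leNgt; apply/negP => hb.
pose S := [set x | a <= x <= b /\ h x <= 0].
have Sa : S a by split; rewrite ?lexx.
have supS : has_sup S by split; [exists a | exists b => x [/andP[]]].
pose t := sup S.
have at_ : a <= t by apply: ub_le_sup => //; exact: supS.2.
have tb : t <= b by apply: ge_sup => [|x [/andP[]]//]; exists a.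
have ht : h t <= 0.
  rewrite leNgt; apply/negP => ht.
  have /subspace_continuousP/(_ t) := ch.
  rewrite /= in_itv/= at_ tb => /(_ isT)/cvgr_gt/(_ _ ht).
  rewrite near_withinE => /nbhs_ballP[e /= e0 He].
  have [x [xab hx] xt] := sup_adherent e0 supS.
  have xt' : x <= t by apply: ub_le_sup => //; exact: supS.2.
  have : 0 < h x.
    apply: He; last by rewrite /= in_itv.
    by rewrite /ball/= ger0_norm ?subr_ge0// ltrBlDl -ltrBlDr.
  by rewrite ltNge hx.
have hpos x : t < x -> x <= b -> 0 < h x.
  move=> tx xb; rewrite ltNge; apply/negP => hx.
  have : S x by split => //; rewrite xb (le_trans at_ (ltW tx)).
  by move/(ub_le_sup supS.2); rewrite leNgt tx.
have d0 x : x \in `]t, b[%R -> exists2 d, is_derive x (1 : R) h d & d <= 0.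
  rewrite in_itv/= => /andP[tx xb]; apply: dh; first by rewrite (le_lt_trans at_).
  exact: hpos (ltW _).
have := @ler0_derive1_le_cc R h t b.
move=> /(_ _ _ _ b t); rewrite !in_itv/= !lexx tb => H.
have : h b <= h t.
  apply: H => //.
  - by move=> x /d0[d hd _]; exact: ex_derive.
  - by move=> x /d0[d hd d_le0]; rewrite derive1E derive_val.
  - by apply: continuous_subspaceW ch; apply: subset_itvr; rewrite bnd_simp.
by move=> /le_trans/(_ ht); rewrite leNgt hb.
Qed.

(** * The nonlinearity near its zeros *)

(** The first-order expansion with an explicit two-sided radius, so that a
    simple zero can be bounded from either side. *)
Lemma derivable_first_order (R : realType) (f : R -> R) (a e : R) :
  derivable f a 1 -> 0 < e ->
  exists2 d, 0 < d & forall u, `|u - a| < d ->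
    `|f u - f a - f^`()%classic a * (u - a)| <= e * `|u - a|.
Proof.
move=> fa e0.
have : h^-1 *: ((f \o shift a) (h *: (1:R)) - f a) @[h --> 0^'] --> f^`()%classic a.
  by rewrite derive1E; exact: fa.
move=> /cvgrPdist_le/(_ _ e0).
rewrite near_withinE => /nbhs_ballP[d /= d0 Hd]; exists d => // u ud.
have [->|ua] := eqVneq u a; first by rewrite !subrr mulr0 subr0 normr0 mulr0.
have ua0 : u - a != 0 by rewrite subr_eq0.
have := Hd (u - a); rewrite /ball/= sub0r normrN => /(_ ud ua0).
rewrite [_ *: 1]mulr1 subrK => H.
have -> : f u - f a - f^`()%classic a * (u - a) =
    - (f^`()%classic a - (u - a)^-1 * (f u - f a)) * (u - a).
  by field.
by rewrite normrM normrN ler_wpM2r.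
Qed.

Lemma pos_of_nonvanishing (R : realType) (f : R -> R) (a b w : R) :
  continuous f -> (forall u, a < u < b -> f u != 0) ->
  a < w < b -> 0 < f w -> forall u, a < u < b -> 0 < f u.
Proof.
move=> cf f0 /andP[aw wb] fw u /andP[au ub]; rewrite ltNge; apply/negP => fu.
have H x y : a < x -> x <= y -> y < b ->
    Num.min (f x) (f y) <= 0 <= Num.max (f x) (f y) -> False.
  move=> ax xy yb Hm; have [|z] := IVT xy _ Hm.
    exact: continuous_subspaceT.
  rewrite in_itv/= => /andP[xz zy]; apply/eqP/f0.
  by rewrite (lt_le_trans ax)//= (le_lt_trans zy).
have [uw|wu] := leP u w.
  by apply: (H u w) => //; rewrite ge_min fu/= le_max (ltW fw) orbT.
by apply: (H w u) => //; [exact: ltW|rewrite ge_min fu orbT/= le_max (ltW fw)].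
Qed.

Lemma C2_derive_bound_lipschitz (R : realType) (f : R -> R) : C2 f ->
  exists2 L, 0 < L & (forall u, 0 <= u <= 1 -> `|f^`()%classic u| <= L) /\
    forall u v, 0 <= u -> u <= v -> v <= 1 -> `|f v - f u| <= L * (v - u).
Proof.
move=> [df ddf _].
have cf' : continuous (fun x => `|f^`()%classic x|).
  move=> x; apply: cvg_norm; apply: differentiable_continuous.
  exact/derivable1_diffP.
have [z _ Hz] := EVT_max (@ler01 R) (continuous_subspaceT cf').
have b' u : 0 <= u <= 1 -> `|f^`()%classic u| <= `|f^`()%classic z| + 1.
  by move=> u01; rewrite (le_trans (Hz u _)) ?in_itv//= lerDl.
exists (`|f^`()%classic z| + 1); first by rewrite ltr_wpDl.
split=> // u v u0 uv v1.
have [||x] := @MVT_segment _ f f^`()%classic u v uv.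
- by move=> x _; rewrite derive1E; exact: derivableP.
- apply: continuous_subspaceT => x; apply: differentiable_continuous.
  exact/derivable1_diffP.
rewrite in_itv/= => /andP[ux xv] ->; rewrite normrM (@ger0_norm _ (v - u)) ?subr_ge0//.
by rewrite ler_wpM2r ?subr_ge0// b'// (le_trans u0)//= (le_trans xv).
Qed.

Lemma C2_continuous (R : realType) (f : R -> R) : C2 f ->
  continuous f /\ continuous f^`()%classic.
Proof.
by move=> [df ddf _]; split=> x; apply: differentiable_continuous;
  exact/derivable1_diffP.
Qed.

(** The sign on each side of [a] is the one dictated by the simple zero at [a],
    as [f] has no other zero in between. *)
Lemma bistable_sign (R : realType) (f : R -> R) (a : R) : bistable f a ->
  (forall u, 0 < u < a -> f u < 0) /\ (forall u, a < u < 1 -> 0 < f u).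
Proof.
move=> [fC2 _ /andP[a0 a1] fz f'a]; have [cf _] := C2_continuous fC2.
have fa : f a = 0 by apply/fz => //; rewrite a0.
have [df _ _] := fC2.
have f'a2 : 0 < f^`()%classic a / 2 by rewrite divr_gt0.
have [d d0 Hd] := derivable_first_order (df a) f'a2.
have fn0 u : 0 < u < 1 -> u != a -> f u != 0.
  by move=> u01; apply: contra_neq => /fz; exact.
(* A step within the expansion radius that keeps [a - s] and [a + s] inside
   ]0, 1[. *)
pose s := Num.min (d / 2) (Num.min (a / 2) ((1 - a) / 2)).
have s0 : 0 < s by rewrite !lt_min; lra.
have sd : s <= d / 2 by rewrite ge_min lexx.
have sa : s <= a / 2 by rewrite !ge_min lexx orbT.
have sb : s <= (1 - a) / 2 by rewrite !ge_min lexx !orbT.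
split.
  suff H : forall u, 0 < u < a -> 0 < (- f) u by move=> u /H; rewrite oppr_gt0.
  apply: (@pos_of_nonvanishing _ _ 0 a (a - s)).
  - by move=> x; apply: continuousN; exact: cf.
  - by move=> u /andP[u0 ua]; rewrite oppr_eq0 fn0 ?lt_eqF// u0 (lt_trans ua).
  - by apply/andP; split; lra.
  - have := Hd (a - s); rewrite fa subr0 addrAC subrr sub0r normrN gtr0_norm//.
    rewrite opprfctE oppr_gt0.
    by rewrite ler_norml => /(_ _)/andP[|_ H]; [lra|nra].
apply: (@pos_of_nonvanishing _ _ a 1 (a + s)) => //.
- by move=> u /andP[ua u1]; rewrite fn0 ?gt_eqF// u1 (lt_trans a0).
- by apply/andP; split; lra.
- have := Hd (a + s); rewrite fa subr0 addrAC subrr add0r gtr0_norm//.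
  by rewrite ler_norml => /(_ _)/andP[|H _]; [lra|nra].
Qed.

(** Both zeros are simple, so [f] is bounded below by linear functions near
    them, and by its positive minimum in between. *)
Lemma bistable_lower_bound (R : realType) (f : R -> R) (a : R) : bistable f a ->
  exists2 m, 0 < m & forall u, a <= u <= 1 -> m * ((u - a) * (1 - u)) <= f u.
Proof.
move=> bf; have [_ fpos] := bistable_sign bf.
have [fC2 [_ f1 _ f'1] /andP[a0 a1] fz f'a] := bf.
have [cf _] := C2_continuous fC2.
have fa : f a = 0 by apply/fz => //; rewrite a0.
have [df _ _] := fC2.
have f'a2 : 0 < f^`()%classic a / 2 by rewrite divr_gt0.
have f'12 : 0 < - f^`()%classic 1 / 2 by rewrite divr_gt0// oppr_gt0.
have [d d0 Hd] := derivable_first_order (df a) f'a2.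
have [e e0 He] := derivable_first_order (df 1) f'12.
(* The linear bounds hold within [s] of [a] and of 1; the two neighbourhoods are
   disjoint. *)
pose s := Num.min (Num.min d e / 2) ((1 - a) / 4).
have s0 : 0 < s by rewrite !lt_min; rewrite divr_gt0 ?lt_min ?d0//; lra.
have sd : s < d.
  have : s <= Num.min d e / 2 by rewrite ge_min lexx.
  have : Num.min d e <= d by rewrite ge_min lexx.
  lra.
have se : s < e.
  have : s <= Num.min d e / 2 by rewrite ge_min lexx.
  have : Num.min d e <= e by rewrite ge_min lexx orbT.
  lra.
have sa : s <= (1 - a) / 4 by rewrite !ge_min lexx orbT.
have [z] := @EVT_min _ f (a + s) (1 - s) ltac:(lra) (continuous_subspaceT cf).
rewrite in_itv/= => zi Hz.
have fz0 : 0 < f z by apply: fpos; move: zi => /andP[]; lra.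
pose m := Num.min (f z) (Num.min (f^`()%classic a / 2) (- f^`()%classic 1 / 2)).
have m0 : 0 < m by rewrite !lt_min fz0 f'a2.
have mz : m <= f z by rewrite ge_min lexx.
have ma : m <= f^`()%classic a / 2 by rewrite !ge_min lexx orbT.
have m1 : m <= - f^`()%classic 1 / 2 by rewrite !ge_min lexx !orbT.
exists m => // u /andP[au u1].
have [[p0 p1] [q0 q1]] :
    (0 <= u - a /\ u - a <= 1) /\ (0 <= 1 - u /\ 1 - u <= 1).
  by split; split; lra.
have [us|us] := ltP u (a + s).
  have := Hd u; rewrite fa subr0 ger0_norm; last by lra.
  rewrite ler_norml => /(_ _)/andP[|H _]; first lra.
  have : f^`()%classic a / 2 * (u - a) <= f u by lra.
  apply: le_trans; rewrite ler_pM ?(ltW m0) ?mulr_ge0 ?ler_piMr ?ler_piMl//.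
have [us'|us'] := ltP (1 - s) u.
  have := He u; rewrite f1 subr0 ler0_norm; last by lra.
  rewrite ler_norml => /(_ _)/andP[|H _]; first lra.
  have : - f^`()%classic 1 / 2 * (1 - u) <= f u by lra.
  apply: le_trans; rewrite ler_pM ?(ltW m0) ?mulr_ge0 ?ler_piMr ?ler_piMl//.
apply: le_trans (Hz u _); last by rewrite in_itv/=; lra.
by apply: le_trans mz; rewrite ler_piMr ?(ltW m0)// mulr_ile1.
Qed.

(** * Integrals with square-root singularities *)

(** The fundamental theorem of calculus for an integrand that may blow up at
    both ends: by monotone convergence the integral is the limit over an exhaustion
    by compact intervals, where the classical version applies. *)
Lemma ge0_FTC2_oo (R : realType) (f F : R -> R) (a b : R) : a < b ->
  (forall x, a < x < b -> 0 <= f x) ->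
  (forall x, a < x < b -> {for x, continuous f}) ->
  {within `[a, b], continuous F} ->
  (forall x, a < x < b -> is_derive x (1 : R) F (f x)) ->
  (\int[lebesgue_measure]_(x in `]a, b[) (f x)%:E = (F b - F a)%:E)%E.
Proof.
move=> ab f0 cf cF dF.
(* The factor 1 / 3 makes [a + e n < b - e n] already for [n = 0]. *)
pose e (n : nat) : R := (b - a) / 3 * (n.+1%:R)^-1.
have n1 n : 0 < (n.+1%:R : R)^-1 <= 1.
  by rewrite invr_gt0 ltr0n/= invf_le1 ?ltr0n// ler1n.
have ba3 : 0 < (b - a) / 3 by rewrite divr_gt0 ?subr_gt0.
have e0 n : 0 < e n by rewrite mulr_gt0//; have /andP[] := n1 n.
have eab n : a + e n < b - e n.
  have : e n <= (b - a) / 3.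
    by rewrite ler_piMr ?(ltW ba3)//; have /andP[] := n1 n.
  lra.
have cve : e n @[n --> \oo] --> (0 : R).
  rewrite -[X in _ --> X](mulr0 ((b - a) / 3)).
  by apply: cvgMr; exact: cvg_harmonic.
pose D (n : nat) : set R := `[a + e n, b - e n].
have Dab n x : D n x -> a < x < b.
  rewrite /D/= in_itv/= => /andP[ax xb]; have := e0 n => en.
  by apply/andP; split; lra.
have sD n : D n `<=` `]a, b[ by move=> x /Dab; rewrite /= in_itv.
have UD : \bigcup_n D n = `]a, b[.
  apply/seteqP; split => [x [n _] /sD//|x /=]; rewrite in_itv/= => /andP[ax xb].
  have : \forall n \near \oo, `|0 - e n| < Num.min (x - a) (b - x).
    by move/cvgrPdist_lt : cve; apply; rewrite lt_min !subr_gt0 ax.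
  move=> [n _ /(_ n (leqnn n))]; rewrite sub0r normrN gtr0_norm// lt_min => /andP[h1 h2].
  by exists n => //; rewrite /D/= in_itv/=; apply/andP; split; lra.
have mf : measurable_fun `]a, b[ f.
  apply: open_continuous_measurable_fun; first exact: interval_open.
  by move=> x; rewrite inE/= in_itv/=; exact: cf.
have cvI : (\int[lebesgue_measure]_(x in D n) (f x)%:E @[n --> \oo] -->
    \int[lebesgue_measure]_(x in `]a, b[) (f x)%:E)%E.
  rewrite -UD; apply: ge0_nondecreasing_set_cvg_integral.
  - move=> n p np; apply/subsetPset => x; rewrite /D/= !in_itv/= => /andP[h1 h2].
    have : e p <= e n.
      by rewrite ler_pM2l ?lef_pV2 ?posrE ?ltr0n// ?ler_nat// divr_gt0 ?subr_gt0.
    by move=> ?; apply/andP; split; lra.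
  - by move=> n; exact: measurable_itv.
  - by move=> n; apply/measurable_EFinP; apply: measurable_funS mf.
  - by move=> n x /Dab ?; rewrite lee_fin f0.
have [cFo cFa cFb] := (continuous_within_itvP F ab).1 cF.
have intD n : (\int[lebesgue_measure]_(x in D n) (f x)%:E =
    (F (b - e n) - F (a + e n))%:E)%E.
  have sDo x : x \in `]a + e n, b - e n[%R -> a < x < b.
    rewrite in_itv/= => /andP[h1 h2]; apply: (@Dab n).
    by rewrite /D/= in_itv/= !ltW.
  rewrite EFinB; apply: continuous_FTC2 (eab n) _ _ _.
  - apply: continuous_in_subspaceT => x; rewrite inE => /Dab; exact: cf.
  - split; first by move=> x /sDo /dF hd; exact: ex_derive.
    + apply/cvg_at_right_filter/cFo; rewrite in_itv/=; apply: (@Dab n).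
      by rewrite /D/= in_itv/= lexx/= ltW.
    + apply/cvg_at_left_filter/cFo; rewrite in_itv/=; apply: (@Dab n).
      by rewrite /D/= in_itv/= lexx/= ltW.
  - by move=> x /sDo /dF hd; rewrite derive1E derive_val.
rewrite -(cvg_lim _ cvI)//; apply/cvg_lim => //.
under eq_cvg do rewrite intD.
apply: cvg_EFin; first exact: nearW.
apply: cvgB.
- apply: (iffLR (cvg_at_leftP _ _ _) cFb).
  split; first by move=> n; rewrite ltrBlDr ltrDl.
  by rewrite -[X in _ --> X](subr0 b); apply: cvgB => //; exact: cvg_cst.
- apply: (iffLR (cvg_at_rightP _ _ _) cFa).
  split; first by move=> n; rewrite ltrDl.
  by rewrite -[X in _ --> X](addr0 a); apply: cvgD => //; exact: cvg_cst.
Qed.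

Lemma is_derive_sqrt_comp (R : realType) (g : R -> R) (x dg : R) :
  0 < g x -> is_derive x (1 : R) g dg ->
  is_derive x (1 : R) (fun u => Num.sqrt (g u)) (dg / (2 * Num.sqrt (g x))).
Proof.
move=> gx dgx.
have ds := is_derive1_sqrt gx.
have := is_derive1_comp ds dgx.
by rewrite mulrC => h; exact: h.
Qed.

(** The comparison function for the singularities of the control density: it
    has the exact primitive [2 sqrt (u - a) - 2 sqrt (b - u)]. *)
Definition edge_weight (R : realType) (a b u : R) : R :=
  (Num.sqrt (u - a))^-1 + (Num.sqrt (b - u))^-1.

Lemma edge_weight_ge0 (R : realType) (a b u : R) : 0 <= edge_weight a b u.
Proof. by rewrite addr_ge0// invr_ge0 sqrtr_ge0. Qed.

Lemma continuous_edge_weight (R : realType) (a b u : R) : a < u < b ->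
  {for u, continuous (edge_weight a b)}.
Proof.
move=> /andP[au ub].
apply: cvgD; apply: cvgV; rewrite ?gt_eqF ?sqrtr_gt0 ?subr_gt0//.
- apply: continuous_comp; last exact: sqrt_continuous.
  by apply: cvgB; [exact: cvg_id|exact: cvg_cst].
- apply: continuous_comp; last exact: sqrt_continuous.
  by apply: cvgB; [exact: cvg_cst|exact: cvg_id].
Qed.

Lemma measurable_edge_weight (R : realType) (a b : R) :
  measurable_fun `]a, b[ (edge_weight a b).
Proof.
apply: open_continuous_measurable_fun; first exact: interval_open.
by move=> x; rewrite inE/= in_itv/=; exact: continuous_edge_weight.
Qed.

(** The two singularities contribute [2 (sqrt (b - a) - sqrt (x - a))] and
    [2 sqrt (b - x)]; the first is at most the second by subadditivity of the
    square root. *)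
Lemma integral_edge_weight_le (R : realType) (a b x : R) : a <= x -> x < b ->
  (\int[lebesgue_measure]_(u in `]x, b[) (edge_weight a b u)%:E
     <= (4 * Num.sqrt (b - x))%:E)%E.
Proof.
move=> ax xb.
have xab u : x < u < b -> a < u < b.
  by move=> /andP[xu ->]; rewrite (le_lt_trans ax).
pose F u := 2 * Num.sqrt (u - a) - 2 * Num.sqrt (b - u).
have -> : (\int[lebesgue_measure]_(u in `]x, b[) (edge_weight a b u)%:E
    = (F b - F x)%:E)%E.
  apply: ge0_FTC2_oo => //.
  - by move=> u _; exact: edge_weight_ge0.
  - by move=> u /xab; exact: continuous_edge_weight.
  - apply: continuous_subspaceT => u; apply: cvgB; apply: cvgMr.
    + apply: continuous_comp; last exact: sqrt_continuous.
      by apply: cvgB; [exact: cvg_id|exact: cvg_cst].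
    + apply: continuous_comp; last exact: sqrt_continuous.
      by apply: cvgB; [exact: cvg_cst|exact: cvg_id].
  - move=> u /xab/andP[au ub].
    have ua0 : 0 < u - a by rewrite subr_gt0.
    have bu0 : 0 < b - u by rewrite subr_gt0.
    have d1 : is_derive u (1 : R) (fun u => u - a) 1.
      by apply: is_derive_eq; rewrite subr0.
    have d2 : is_derive u (1 : R) (fun u => b - u) (- 1).
      by rewrite -sub0r; exact: is_deriveB.
    have dF := is_deriveB (is_deriveZ 2 (is_derive_sqrt_comp (g := fun v => v - a) ua0 d1))
      (is_deriveZ 2 (is_derive_sqrt_comp (g := fun v => b - v) bu0 d2)).
    apply: (is_derive_eq dF); rewrite /edge_weight /GRing.scale/=.
    by field; rewrite !gt_eqF ?sqrtr_gt0.
rewrite /F subrr sqrtr0 mulr0 subr0 lee_fin.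
have : Num.sqrt (b - a) <= Num.sqrt (x - a) + Num.sqrt (b - x).
  rewrite -(@ler_pXn2r _ 2)// ?nnegrE ?addr_ge0 ?sqrtr_ge0//.
  rewrite sqrrD !sqr_sqrtr ?subr_ge0//; try lra.
  have : 0 <= Num.sqrt (x - a) * Num.sqrt (b - x) by rewrite mulr_ge0// sqrtr_ge0.
  by rewrite mulr2n; lra.
lra.
Qed.

(** Integrability and a tail estimate for a function with at most square-root
    singularities at the ends. The tail decides the order of the error term: with
    [1 - up c = O (1 / c ^ 2)] it is [O (1 / c)]. *)
Lemma edge_weight_dominated (R : realType) (g : R -> R) (a b N : R) : a < b ->
  0 <= N ->
  (forall u, a < u < b -> {for u, continuous g}) ->
  (forall u, a < u < b -> `|g u| <= N * edge_weight a b u) ->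
  lebesgue_measure.-integrable `[a, b] (EFin \o g) /\
  forall x, a <= x -> x < b ->
    `|\int[lebesgue_measure]_(u in `]x, b]) g u| <= 4 * N * Num.sqrt (b - x).
Proof.
move=> ab N0 cg gN.
have mg : measurable_fun `]a, b[ g.
  apply: open_continuous_measurable_fun; first exact: interval_open.
  by move=> x; rewrite inE/= in_itv/=; exact: cg.
have mgcc : measurable_fun `[a, b] g by exact: measurable_fun_itv_cc mg.
have abs_le x : a <= x -> x < b ->
    (\int[lebesgue_measure]_(u in `]x, b[) `|(g u)%:E| <=
      (4 * N * Num.sqrt (b - x))%:E)%E.
  move=> ax xb.
  have sub : `]x, b[ `<=` `]a, b[ by apply: subset_itvr; rewrite bnd_simp.
  have mw : measurable_fun `]x, b[ (edge_weight a b).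
    exact: measurable_funS (@measurable_edge_weight _ a b).
  apply: (@le_trans _ _
     (\int[lebesgue_measure]_(u in `]x, b[) (N%:E * (edge_weight a b u)%:E))%E).
    apply: ge0_le_integral => //.
    - apply/measurableT_comp => //; apply/measurable_EFinP.
      exact: measurable_funS mg.
    - apply: measurable_funeM; exact/measurable_EFinP.
    - move=> u /=; rewrite in_itv/= => /andP[xu ub].
      by rewrite -EFinM lee_fin gN// ub (le_lt_trans ax).
  rewrite ge0_integralZl//; last 2 first.
  - exact/measurable_EFinP.
  - by move=> u _; rewrite lee_fin edge_weight_ge0.
  rewrite (_ : 4 * N * _ = N * (4 * Num.sqrt (b - x))); last by ring.
  by rewrite EFinM lee_wpmul2l// integral_edge_weight_le.
have ig : lebesgue_measure.-integrable `[a, b] (EFin \o g).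
  apply/integrableP; split; first exact/measurable_EFinP.
  rewrite integral_itv_bndoo; first exact: le_lt_trans (abs_le _ _ _) (ltry _).
  by apply/measurableT_comp => //; exact/measurable_EFinP.
split=> // x ax xb.
have sub : `]x, b] `<=` `[a, b] by apply: subset_itvr; rewrite bnd_simp.
have igx : lebesgue_measure.-integrable `]x, b] (EFin \o g).
  exact: integrableS ig.
rewrite -lee_fin EFin_normr_Rintegral//.
apply: le_trans (abs_le x ax xb).
apply: le_trans (le_abse_integral _ _ _) _ => //; first exact: measurable_int igx.
rewrite integral_itv_bndoo//.
apply/measurableT_comp => //; apply/measurable_EFinP; apply: measurable_funS mg => //.
by apply: subset_itvr; rewrite bnd_simp.
Qed.

(** * Orbits in the phase plane *)

(** The line [(c / 2) (a - u)] is a supersolution of [P' = - c - f / P]: where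
    [P] lies above it, [- f / P <= L (a - u) / P <= 2 L / c <= c / 2], hence
    [P' <= - c / 2]. *)
Lemma uncontrolled_orbit_lands (R : realType) (f P : R -> R) (a c L : R) :
  0 < a -> 0 < c -> 4 * L <= c ^+ 2 ->
  (forall u, 0 < u < a -> - f u <= L * (a - u)) ->
  {within `[0, a], continuous P} -> P 0 = 0 ->
  (forall u, 0 < u < a -> 0 < P u ->
    is_derive u (1 : R) P (- c - f u / P u)) ->
  P a <= 0.
Proof.
move=> a0 c0 cL fL cP P0 dP.
pose h u := P u - c / 2 * (a - u).
suff : h a <= 0 by rewrite /h subrr mulr0 subr0.
apply: (@nonpos_barrier _ _ 0 a (ltW a0)).
- move=> u; apply: cvgB; first exact: cP.
  apply: (continuous_subspaceT (f := fun u => c / 2 * (a - u))) => v.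
  by apply: cvgMr; apply: cvgB; [exact: cvg_cst|exact: cvg_id].
- by rewrite /h P0 subr0 sub0r oppr_le0 mulr_ge0 ?(ltW a0)// divr_ge0// ltW.
- move=> u u0a hu.
  have ua : 0 < a - u by rewrite subr_gt0; case/andP: u0a.
  have hu' : c / 2 * (a - u) < P u by rewrite -subr_gt0.
  have Pu : 0 < P u by apply: lt_trans hu'; rewrite mulr_gt0// divr_gt0.
  have dl : is_derive u (1 : R) (fun u => a - u) (- 1).
    by rewrite -sub0r; exact: is_deriveB.
  have dh := is_deriveB (dP u u0a Pu) (is_deriveZ (c / 2) dl).
  exists (- c - f u / P u - (c / 2) *: (- 1)); first exact: dh.
  rewrite /GRing.scale/=.
  have : - f u / P u <= c / 2.
    rewrite ler_pdivrMr//; apply: le_trans (fL u u0a) _.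
    apply: le_trans (ler_wpM2l _ (ltW hu')); last by rewrite divr_ge0// ltW.
    by rewrite mulrA ler_wpM2r// ?(ltW ua)//; lra.
  lra.
Qed.

(** The function [s u = sqrt (u * f u)] solves the same equation, and
    [D = P - s] satisfies [D' = f D / (P s)]. Where [D > 0] this is at most
    [f D / s ^ 2 = D / u], so [D / u] does not increase. Only an
    inequality is available: at a simple zero [a] of [f], [s] is not differentiable
    and several solutions start from [(a, 0)]. *)
Lemma controlled_orbit_below_arc (R : realType) (f P : R -> R) (a b : R) :
  0 < a -> a < b ->
  (forall u, derivable f u 1) ->
  (forall u, a < u <= b -> 0 < f u) ->
  {within `[a, b], continuous P} -> P a = 0 ->
  (forall u, a < u < b -> 0 < P u -> is_derive u (1 : R) P
    (- (f u / P u) + (3 * f u + u * f^`()%classic u) / (2 * Num.sqrt (u * f u)))) ->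
  P b <= Num.sqrt (b * f b).
Proof.
move=> a0 ab df f0 cP Pa dP.
pose s u := Num.sqrt (u * f u).
have cs : continuous s.
  move=> u; apply: continuous_comp; last exact: sqrt_continuous.
  apply: cvgM; first exact: cvg_id.
  by apply: differentiable_continuous; exact/derivable1_diffP.
have cid : {within `[a, b], continuous (fun u : R => u^-1)}.
  apply: continuous_in_subspaceT => u; rewrite inE/= in_itv/= => /andP[au _].
  by apply: cvgV; [rewrite gt_eqF// (lt_le_trans a0)|exact: cvg_id].
pose h u := (P u - s u) * u^-1.
suff : h b <= 0.
  by rewrite /h pmulr_lle0 ?invr_gt0 ?(lt_trans a0)// subr_le0.
apply: (@nonpos_barrier _ _ a b (ltW ab)).
- move=> u; apply: cvgM; last exact: cid.
  by apply: cvgB; [exact: cP|exact: (continuous_subspaceT cs)].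
- rewrite /h Pa sub0r mulNr oppr_le0 mulr_ge0 ?sqrtr_ge0//.
  by rewrite invr_ge0 ltW.
- move=> u uab hu; have /andP[au ub] := uab.
  have u0 : 0 < u := lt_trans a0 au.
  have fu : 0 < f u by rewrite f0// au ltW.
  have uf0 : 0 < u * f u by rewrite mulr_gt0.
  have su : 0 < s u by rewrite sqrtr_gt0.
  have ss : s u ^+ 2 = u * f u by rewrite sqr_sqrtr// ltW.
  have sP : s u < P u by move: hu; rewrite /h pmulr_lgt0 ?invr_gt0// subr_gt0.
  have Pu := lt_trans su sP.
  have dfu : is_derive u (1 : R) f (f^`()%classic u).
    by rewrite derive1E; exact: derivableP.
  have duf : is_derive u (1 : R) (fun u => u * f u) (u *: f^`()%classic u + f u *: 1).
    exact: (is_deriveM (is_derive_id u (1 : R)) dfu).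
  have ds := is_derive_sqrt_comp (g := fun u => u * f u) uf0 duf.
  have dV := is_deriveV (lt0r_neq0 u0) (is_derive_id u (1 : R)).
  have dh := is_deriveM (is_deriveB (dP u uab Pu) ds) dV.
  eexists; first exact: dh.
  rewrite /GRing.scale/= -/(s u).
  have -> : (P u - s u) * (- u ^- 2 * 1) + u^-1 *
     (- (f u / P u) + (3 * f u + u * f^`()%classic u) / (2 * s u)
        - (u * f^`()%classic u + f u * 1) / (2 * s u))
     = - ((P u - s u) ^+ 2 / (u ^+ 2 * P u)).
    have -> : f u = s u ^+ 2 / u by rewrite ss mulrC mulKf// gt_eqF.
    by field; rewrite !gt_eqF.
  by rewrite oppr_le0 divr_ge0 ?sqr_ge0// mulr_ge0 ?sqr_ge0// ltW.
Qed.

(** An orbit landing at [(a, 0)] cannot climb without control, which gives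
    [um = a]. At [up] two bounds meet: [P up <= sqrt (L (1 - up))], because the
    orbit is below the arc, and [P up >= c (1 - up)], because it descends to (1, 0)
    without control. *)
Lemma fast_switching_points (R : realType) (f : R -> R) (a c L um up : R) :
  bistable f a -> 0 < L ->
  (forall u v, 0 <= u -> u <= v -> v <= 1 -> `|f v - f u| <= L * (v - u)) ->
  0 < c -> 4 * L <= c ^+ 2 -> switching_points f a c um up ->
  um = a /\ c ^+ 2 * (1 - up) <= L.
Proof.
move=> bf L0 Lf c0 cL [aum umup up1 [P [_ cP [P0 P1] [Pge0 Pgt0] dP]] _].
have [fneg fpos] := bistable_sign bf.
have [[df _ _] [_ f1 _ _] /andP[a0 a1] fz _] := bf.
have fa : f a = 0 by apply/fz => //; rewrite a0.
have cPs x y : 0 <= x -> y <= 1 -> {within `[x, y], continuous P}.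
  move=> x0 y1; apply: continuous_subspaceW cP.
  by apply: subset_itv; rewrite bnd_simp.
have dP0 u : 0 < u < 1 -> (u < um) || (up < u) -> 0 < P u ->
    is_derive u (1 : R) P (- c - f u / P u).
  move=> u01 out Pu; have := dP u u01.
  rewrite /zstar; case: ifPn => [/andP[]|_]; first by case/orP: out => ?; lra.
  rewrite addr0; apply => //.
    by case/orP: out => ?; [rewrite lt_eqF|rewrite gt_eqF ?(lt_trans umup)].
  by case/orP: out => ?; [rewrite lt_eqF ?(lt_trans _ umup)|rewrite gt_eqF].
have Pa : P a = 0.
  apply: le_anti; rewrite Pge0 ?a0// andbT.
  apply: (@uncontrolled_orbit_lands _ f P a c L) => //.
  - move=> u /andP[u0 ua]; have := Lf u a (ltW u0) (ltW ua) (ltW a1).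
    by rewrite fa sub0r; apply: le_trans; rewrite ler_norm.
  - by apply: cPs => //; exact: ltW.
  - move=> u /andP[u0 ua] Pu; apply: dP0 => //.
      by rewrite u0 (lt_trans ua).
    by rewrite (lt_le_trans ua).
(* Were [a < um], the orbit would start from zero at [a] and decrease up to [um]. *)
have uma : um = a.
  apply/eqP; rewrite eq_le aum andbT leNgt; apply/negP => aum'.
  have um01 : 0 < um < 1 by rewrite (lt_trans a0)// (lt_trans umup).
  have := Pgt0 um um01; rewrite gt_eqF// => /(_ isT); rewrite ltNge => /negP; apply.
  apply: (@nonpos_barrier _ P a um) => //; rewrite ?Pa//.
    by apply: cPs; rewrite ltW//; case/andP: um01.
  move=> u /andP[au uum] Pu; have u1 : u < 1 by lra.
  exists (- c - f u / P u); first by apply: dP0; rewrite ?uum ?u1 ?(lt_trans a0 au).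
  have : 0 < f u / P u by rewrite divr_gt0// fpos// au.
  lra.
split=> //; move: aum umup dP dP0; rewrite uma => _ aup dP dP0.
have up0 : 0 < up := lt_trans a0 aup.
have fup : 0 < f up by rewrite fpos// aup.
have Pup : P up <= Num.sqrt (up * f up).
  apply: (@controlled_orbit_below_arc _ f P a) => //.
  - by move=> u /andP[au uup]; rewrite fpos// au (le_lt_trans uup).
  - by apply: cPs; rewrite ltW.
  - move=> u /andP[au uup] Pu; have u1 := lt_trans uup up1.
    have u01 : 0 < u < 1 by rewrite (lt_trans a0).
    have := dP u u01; rewrite gt_eqF// lt_eqF// /zstar !ltW//= => /(_ isT isT Pu).
    move/is_derive_eq; apply; ring.
(* The uncontrolled orbit descends to (1, 0) with slope at most [- c]. *)
have cup : c * (1 - up) <= P up.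
  pose h u := P u - P up + c * (u - up).
  suff : h 1 <= 0 by rewrite /h P1; lra.
  apply: (@nonpos_barrier _ h up 1 (ltW up1)).
  - move=> u; apply: cvgD.
      by apply: cvgB; [exact: (cPs up 1 (ltW up0) (lexx _))|exact: cvg_cst].
    apply: (continuous_subspaceT (f := fun u => c * (u - up))) => v.
    by apply: cvgMr; apply: cvgB; [exact: cvg_id|exact: cvg_cst].
  - by rewrite /h !subrr mulr0 addr0.
  - move=> u /andP[upu u1] _.
    have u01 : 0 < u < 1 by rewrite (lt_trans up0).
    have Pu : 0 < P u by rewrite Pgt0// gt_eqF// (lt_trans aup).
    have dPu := dP0 u u01 ltac:(by rewrite upu orbT) Pu.
    have dl : is_derive u (1 : R) (fun u => u - up) 1.
      by apply: is_derive_eq; rewrite subr0.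
    have dh := is_deriveD (is_deriveB dPu (is_derive_cst (P up) u (1 : R)))
      (is_deriveZ c dl).
    eexists; first exact: dh.
    rewrite /GRing.scale/=.
    have : 0 < f u / P u by rewrite divr_gt0// fpos// u1 (lt_trans aup).
    lra.
have q0 : 0 < 1 - up by rewrite subr_gt0.
have fL : f up <= L * (1 - up).
  have := Lf up 1 (ltW up0) (ltW up1) (lexx _).
  by rewrite f1 sub0r normrN; apply: le_trans; rewrite ler_norm.
rewrite -(ler_pM2r q0); apply: le_trans fL.
have : (c * (1 - up)) ^+ 2 <= up * f up.
  rewrite -[leRHS]sqr_sqrtr; last by rewrite mulr_ge0// ltW.
  rewrite ler_sqr ?nnegrE ?sqrtr_ge0 ?(le_trans cup)//.
  by rewrite mulr_ge0// ltW.
have : up * f up <= f up by rewrite ler_piMl// ltW.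
by rewrite exprMn (expr2 (1 - up)) mulrA => h1 h2; exact: le_trans h2 h1.
Qed.

(** * The cost *)

(** The control density [zstar / u] without its term [c / u]. *)
Definition arc_density (R : realType) (f : R -> R) (u : R) : R :=
  3 * Num.sqrt (f u) / (2 * u * Num.sqrt u)
  + f^`()%classic u / (2 * Num.sqrt (u * f u)).

(** The case [f u = 0] is needed at [u = ustar], the left end of the controlled
    interval for large [c]; both fractions are then zero, as inverses of zero
    are. *)
Lemma zstar_arc_density (R : realType) (f : R -> R) (c um up u : R) :
  0 < u -> 0 <= f u -> um <= u <= up ->
  zstar f c um up u / u = arc_density f u + c / u.
Proof.
move=> u0 fu umup; rewrite /zstar umup /arc_density sqrtrM ?ltW//.
have [->|] := eqVneq (f u) 0.
  by rewrite sqrtr0 !(mulr0, mul0r, invr0, add0r).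
rewrite neq_lt ltNge fu/= => {}fu.
have s0 : 0 < Num.sqrt u by rewrite sqrtr_gt0.
have t0 : 0 < Num.sqrt (f u) by rewrite sqrtr_gt0.
have -> : 3 * f u = 3 * Num.sqrt (f u) ^+ 2 by rewrite sqr_sqrtr// ltW.
by field; rewrite !gt_eqF.
Qed.

Lemma continuous_arc_density (R : realType) (f : R -> R) (u : R) :
  C2 f -> 0 < u -> 0 < f u -> {for u, continuous (arc_density f)}.
Proof.
move=> /C2_continuous[cf cf'] u0 fu.
have csf : {for u, continuous (fun v : R => Num.sqrt (f v))}.
  by apply: continuous_comp; [exact: cf|exact: sqrt_continuous].
have csu : {for u, continuous (fun v : R => Num.sqrt (v * f v))}.
  apply: (@continuous_comp _ _ _ (fun v : R => v * f v) Num.sqrt).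
    by apply: cvgM; [exact: cvg_id|exact: cf].
  exact: sqrt_continuous.
apply: cvgD; apply: cvgM.
- by apply: cvgMr.
- apply: cvgV; first by rewrite mulf_neq0// gt_eqF ?mulr_gt0 ?sqrtr_gt0.
  apply: cvgM; last exact: sqrt_continuous.
  by apply: cvgMr; exact: cvg_id.
- exact: cf'.
- apply: cvgV; first by rewrite gt_eqF ?mulr_gt0 ?sqrtr_gt0// mulr_gt0.
  exact: cvgMr.
Qed.

(** Near the simple zeros of [f] the density behaves like [1 / sqrt f], and
    [1 / (sqrt (u - a) * sqrt (1 - u))] is dominated by the sum of the two factors. *)
Lemma arc_density_bound (R : realType) (f : R -> R) (a : R) : bistable f a ->
  exists2 N, 0 < N & forall u, a < u < 1 ->
    `|arc_density f u| <= N * edge_weight a 1 u.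
Proof.
move=> bf; have [m m0 Hm] := bistable_lower_bound bf.
have [_ fpos] := bistable_sign bf.
have [fC2 [_ f1 _ _] /andP[a0 a1] _ _] := bf.
have [L L0 [Lf' Lf]] := C2_derive_bound_lipschitz fC2.
pose k := 2 * a * Num.sqrt (a * m) * Num.sqrt (1 - a).
have sam : 0 < Num.sqrt (a * m) by rewrite sqrtr_gt0 mulr_gt0.
have sa1 : 0 < Num.sqrt (1 - a) by rewrite sqrtr_gt0 subr_gt0.
have k0 : 0 < k by rewrite /k !mulr_gt0.
exists (4 * L / k); first by rewrite !mulr_gt0// invr_gt0.
move=> u /andP[au u1].
have u0 : 0 < u := lt_trans a0 au.
have fu : 0 < f u by rewrite fpos// au.
have -> : arc_density f u =
    (3 * f u + u * f^`()%classic u) / (2 * u * Num.sqrt (u * f u)).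
  have uu : u <= u <= u by rewrite lexx.
  have := zstar_arc_density 0 u0 (ltW fu) uu.
  rewrite mul0r addr0 => <-; rewrite /zstar lexx/= addr0.
  by field; rewrite !gt_eqF// sqrtr_gt0 mulr_gt0.
pose p := Num.sqrt (u - a); pose q := Num.sqrt (1 - u).
have p0 : 0 < p by rewrite sqrtr_gt0 subr_gt0.
have q0 : 0 < q by rewrite sqrtr_gt0 subr_gt0.
(* From [u >= a] and [f u >= m (p q) ^ 2]. *)
have den : 2 * a * (Num.sqrt (a * m) * (p * q)) <= 2 * u * Num.sqrt (u * f u).
  apply: ler_pM.
  - by rewrite mulr_ge0// ltW.
  - by rewrite !mulr_ge0 ?sqrtr_ge0// ltW.
  - by rewrite ler_pM2l// ltW.
  - have am0 : 0 <= a * m by rewrite ltW// mulr_gt0.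
    have ua0 : 0 <= u - a by rewrite subr_ge0 ltW.
    rewrite /p /q -!sqrtrM// ler_sqrt; last by rewrite ltW// mulr_gt0.
    rewrite -mulrA ler_pM ?(ltW a0) ?(ltW au)//.
      by rewrite !mulr_ge0 ?subr_ge0// ltW.
    by rewrite Hm// !ltW.
have num : `|3 * f u + u * f^`()%classic u| <= 4 * L.
  have h1 : `|3 * f u| <= 3 * L.
    rewrite normrM ger0_norm// ler_pM2l//.
    have := Lf u 1 (ltW u0) (ltW u1) (lexx _).
    rewrite f1 sub0r normrN => /le_trans; apply.
    by rewrite ler_piMr ?(ltW L0)//; lra.
  have h2 : `|u * f^`()%classic u| <= L.
    rewrite normrM gtr0_norm//.
    have u01 : 0 <= u <= 1 by rewrite (ltW u0) (ltW u1).
    by apply: le_trans (Lf' u u01); rewrite ler_piMl// ltW.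
  apply: le_trans (ler_normD _ _) _; lra.
rewrite normrM normfV [X in _ / X]gtr0_norm; last first.
  by rewrite !mulr_gt0// sqrtr_gt0 mulr_gt0.
have d0 : 0 < 2 * a * (Num.sqrt (a * m) * (p * q)) by rewrite !mulr_gt0.
apply: (@le_trans _ _ (4 * L / (2 * a * (Num.sqrt (a * m) * (p * q))))).
  apply: ler_pM => //; first by rewrite invr_ge0 (le_trans (ltW d0)).
  by rewrite lef_pV2// ?posrE// (lt_le_trans d0).
(* Squaring: [p ^ 2 + q ^ 2 = 1 - a]. *)
have spq : Num.sqrt (1 - a) <= p + q.
  rewrite -(@ler_pXn2r _ 2)// ?nnegrE ?addr_ge0 ?sqrtr_ge0//.
  rewrite sqrrD !sqr_sqrtr ?subr_ge0 ?(ltW au) ?(ltW u1) ?(ltW a1)//.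
  have : 0 < p * q by rewrite mulr_gt0.
  by rewrite mulr2n; lra.
have -> : 4 * L / (2 * a * (Num.sqrt (a * m) * (p * q))) =
    4 * L / k * (Num.sqrt (1 - a) / (p * q)).
  by rewrite /k; field; rewrite !gt_eqF.
rewrite ler_wpM2l//; first by rewrite ltW// divr_gt0// mulr_gt0.
have -> : edge_weight a 1 u = (p + q) / (p * q).
  by rewrite /edge_weight -/p -/q; field; rewrite !gt_eqF.
by rewrite ler_wpM2r// invr_ge0 ltW// mulr_gt0.
Qed.

Lemma min_cost_formula (R : realType) (f : R -> R) (a c um up : R) :
  bistable f a ->
  lebesgue_measure.-integrable `[a, 1] (EFin \o arc_density f) ->
  switching_points f a c um up ->
  min_cost f c = (\int[lebesgue_measure]_(u in `[um, up]) arc_density f u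
                  + c * (ln up - ln um))%:E.
Proof.
move=> bf ig [aum umup up1 _ ->].
have [_ fpos] := bistable_sign bf.
have [_ _ /andP[a0 a1] fz _] := bf.
have fa : f a = 0 by apply/fz => //; rewrite a0.
have um0 : 0 < um := lt_le_trans a0 aum.
have igu : lebesgue_measure.-integrable `[um, up] (EFin \o arc_density f).
  apply: integrableS ig => //.
  by apply: subset_itv; rewrite bnd_simp// ltW.
have cinv : {within `[um, up], continuous (fun u : R => c / u)}.
  apply: continuous_in_subspaceT => u; rewrite inE/= in_itv/= => /andP[umu _].
  by apply: cvgMr; apply: cvgV; [rewrite gt_eqF// (lt_le_trans um0)|exact: cvg_id].
have ici : lebesgue_measure.-integrable `[um, up] (EFin \o (fun u : R => c / u)).
  by apply: continuous_compact_integrable => //; exact: segment_compact.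
have dln x : um < x -> is_derive x (1 : R) (fun u => c * ln u) (c / x).
  move=> umx; have := is_deriveZ c (is_derive1_ln (lt_trans um0 umx)).
  by move/is_derive_eq; apply.
have cln x : um <= x -> (fun u : R => c * ln u) @ x --> c * ln x.
  move=> umx; apply: cvgMr; apply: continuous_ln; exact: lt_le_trans umx.
have -> : (\int[lebesgue_measure]_(u in `[um, up]) (zstar f c um up u / u)%:E =
    \int[lebesgue_measure]_(u in `[um, up])
      ((arc_density f u)%:E + (c / u)%:E))%E.
  apply: eq_integral => u; rewrite inE/= in_itv/= => umup'.
  have /andP[umu uup] := umup'.
  rewrite zstar_arc_density ?EFinD// ?(lt_le_trans um0)//.
  have [<-|ua] := eqVneq a u; first by rewrite fa.
  rewrite ltW// fpos// (le_lt_trans uup)// andbT lt_neqAle ua/=.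
  exact: le_trans umu.
rewrite integralD_EFin//.
have -> : (\int[lebesgue_measure]_(u in `[um, up]) (c / u)%:E =
    (c * ln up)%:E - (c * ln um)%:E)%E.
  apply: (@continuous_FTC2 _ _ (fun u => c * ln u)) => //.
  - split; first by move=> x; rewrite in_itv/= => /andP[/dln hd _]; exact: ex_derive.
    + by apply/cvg_at_right_filter/cln.
    + by apply/cvg_at_left_filter/cln; exact: ltW.
  - move=> x; rewrite in_itv/= => /andP[/dln hd _].
    by rewrite derive1E derive_val.
by rewrite -EFinB -mulrBr EFinD /Rintegral fineK//; exact: integrable_fin_num.
Qed.

Lemma norm_ln_le (R : realType) (a x : R) : 0 < a -> a <= x -> x <= 1 ->
  `|ln x| <= (1 - x) / a.
Proof.
move=> a0 ax x1; have x0 : 0 < x := lt_le_trans a0 ax.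
rewrite ler0_norm ?ln_le0// -lnV ?posrE//.
have -> : x^-1 = 1 + (x^-1 - 1) by lra.
apply: le_trans (le_ln1Dx _) _.
  by rewrite (lt_le_trans (@ltrN10 _))// subr_ge0 invf_ge1.
have -> : x^-1 - 1 = (1 - x) / x by field; rewrite gt_eqF.
by rewrite ler_pM ?subr_ge0 ?invr_ge0 ?(ltW x0)// lef_pV2.
Qed.

(** * Asymptotics for large speeds *)

Theorem proposition5p1 (R : realType) (f : R -> R) (ustar cstar : R)
    (um up : R -> R)
    (hA2 : bistable f ustar)
    (hA4 : assumption_A4 f ustar)
    (hcstar : critical_speed f cstar)
    (hopt : forall c : R, cstar < c ->
      switching_points f ustar c (um c) (up c)) :
  [/\ um c @[c --> +oo%R] --> ustar,
      up c @[c --> +oo%R] --> (1 : R) &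
      exists e : R -> R,
        (forall c : R, cstar < c ->
          min_cost f c =
            ((c * `|ln ustar|)%:E
             + \int[lebesgue_measure]_(u in `[ustar, 1%R])
                 (3 * Num.sqrt (f u) / (2 * u * Num.sqrt u)
                  + f^`()%classic u / (2 * Num.sqrt (u * f u)))%:E
             + (e c)%:E)%E) /\
        exists2 K : R, 0 < K & \forall c \near +oo%R, `|e c| <= K * c^-1].
Proof.
have [fC2 _ /andP[a0 a1] _ _] := hA2.
have [_ fpos] := bistable_sign hA2.
have [L L0 [_ Lf]] := C2_derive_bound_lipschitz fC2.
have [N N0 HN] := arc_density_bound hA2.
have cont u : ustar < u < 1 -> {for u, continuous (arc_density f)}.
  move=> /[dup] uab /andP[au _].
  by apply: continuous_arc_density; rewrite ?fpos// (lt_trans a0).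
have [ig tail] := edge_weight_dominated a1 (ltW N0) cont HN.
have ev : \forall c \near +oo%R,
    [/\ cstar < c, 0 < c, um c = ustar & c ^+ 2 * (1 - up c) <= L].
  near=> c.
  have cs : cstar < c by near: c; apply: nbhs_pinfty_gt; exact: num_real.
  have c1 : 1 < c by near: c; apply: nbhs_pinfty_gt; exact: num_real.
  have cL : 4 * L < c by near: c; apply: nbhs_pinfty_gt; exact: num_real.
  (* As [c > 1], the bound [c > 4 L] is enough. *)
  have cL2 : 4 * L <= c ^+ 2.
    by apply: le_trans (ltW cL) _; rewrite expr2 ler_peMl// ltW// (lt_trans _ c1).
  have c0 : 0 < c by exact: lt_trans c1.
  have [? ?] := fast_switching_points hA2 L0 Lf c0 cL2 (hopt c cs).
  by split.
have upv : \forall c \near +oo%R, 0 < c /\ `|1 - up c| <= L / c.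
  near=> c.
  have [cs c0 _ cup] : [/\ cstar < c, 0 < c, um c = ustar &
    c ^+ 2 * (1 - up c) <= L] by near: c.
  have c1 : 1 < c by near: c; apply: nbhs_pinfty_gt; exact: num_real.
  have [_ _ up1 _ _] := hopt c cs.
  split => //; rewrite gtr0_norm ?subr_gt0// ler_pdivlMr// mulrC.
  apply: le_trans cup; rewrite expr2 -mulrA ler_peMl ?(ltW c1)//.
  by rewrite mulr_ge0 ?(ltW c0)// subr_ge0 ltW.
split.
- apply: cvg_near_cst; near=> c.
  by have [] : [/\ cstar < c, 0 < c, um c = ustar &
    c ^+ 2 * (1 - up c) <= L] by near: c.
- apply/cvgrPdist_le => d d0; near=> c.
  have [c0 cup] : 0 < c /\ `|1 - up c| <= L / c by near: c.
  have Ldc : L / d <= c by near: c; apply: nbhs_pinfty_ge; exact: num_real.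
  by apply: le_trans cup _; rewrite ler_pdivrMr// mulrC -ler_pdivrMr.
pose I := \int[lebesgue_measure]_(u in `[ustar, 1]) arc_density f u.
exists (fun c => fine (min_cost f c) - c * `|ln ustar| - I); split.
  move=> c cs; rewrite (min_cost_formula hA2 ig (hopt c cs)).
  have IE : (\int[lebesgue_measure]_(u in `[ustar, 1%R]) (arc_density f u)%:E =
      I%:E)%E.
    by rewrite /I /Rintegral fineK//; apply: integrable_fin_num.
  rewrite [X in (_ + X + _)%E](_ : _ = I%:E); last exact: IE.
  by rewrite -!EFinD/=; congr EFin; ring.
(* [e c = c ln (up c)] minus the integral of the density over [up c, 1]; the two
   parts give the two terms of the constant. *)
exists (4 * N * Num.sqrt L + L / ustar).
  by rewrite addr_gt0// ?divr_gt0// !mulr_gt0// sqrtr_gt0.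
near=> c.
have [cs c0 umc cup] : [/\ cstar < c, 0 < c, um c = ustar &
  c ^+ 2 * (1 - up c) <= L] by near: c.
have sp := hopt c cs; have [_ + up1 _ _] := sp; rewrite umc => aup.
rewrite (min_cost_formula hA2 ig sp) umc/=.
have -> : \int[lebesgue_measure]_(u in `[ustar, up c]) arc_density f u =
    I - \int[lebesgue_measure]_(u in `](up c), 1]) arc_density f u.
  have <- := @Rintegral_itvB _ _ (BLeft ustar) (BRight 1) (up c) ig.
  - by rewrite /I; ring.
  - by rewrite bnd_simp ltW.
  - by rewrite bnd_simp ltW.
rewrite (@ler0_norm _ (ln ustar)); last by rewrite ln_le0// ltW.
set T := (X in I - X).
have -> : I - T + c * (ln (up c) - ln ustar) - c * - ln ustar - I =
    c * ln (up c) - T by ring.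
apply: le_trans (ler_normB _ _) _.
have up1' : 1 - up c <= L / c ^+ 2 by rewrite ler_pdivlMr ?exprn_gt0// mulrC.
have hT : `|T| <= 4 * N * Num.sqrt L / c.
  apply: le_trans (tail (up c) (ltW aup) up1) _.
  rewrite -[leRHS]mulrA ler_wpM2l//; first by rewrite mulr_ge0// ltW.
  rewrite -[c in leRHS](@ger0_norm _ c) ?(ltW c0)// -sqrtr_sqr -sqrtrV ?sqr_ge0//.
  by rewrite -sqrtrM ?(ltW L0)// ler_sqrt// divr_ge0 ?sqr_ge0// ltW.
have hl : `|c * ln (up c)| <= L / ustar / c.
  rewrite normrM gtr0_norm//.
  apply: (@le_trans _ _ (c * ((L / c ^+ 2) / ustar))).
    rewrite ler_pM2l//; apply: le_trans (norm_ln_le a0 (ltW aup) (ltW up1)) _.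
    by rewrite ler_pM2r// invr_gt0.
  by rewrite le_eqVlt; apply/orP; left; apply/eqP; field; rewrite !gt_eqF.
rewrite mulrDl addrC; exact: lerD.
Unshelve. all: by end_near. Qed.
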